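(* Let $(H,X)$ be an admissible pair. If a nonzero vector $\varphi$ in $H$ is norm attaining in $X$, then $\varphi$ is a Hilbert point in $X$.
   Context: All spaces are over the complex numbers, and $\langle\cdot,\cdot\rangle$ is the inner product of $H$. An admissible pair $(H,X)$ is a Hilbert space $H$ that can be embedded as a dense subspace of a Banach space $X$ such that the norm of the embedding is $1$; $H$ is identified with its image in $X$, so $\|f\|_X \leq \|f\|_H$ for every $f$ in $H$. A nonzero vector $\varphi$ in $H$ is called norm attaining in $X$ if $\|\varphi\|_X = \|\varphi\|_H$. A nonzero vector $\varphi$ in $H$ is called a Hilbert point in $X$ if $\|\varphi+f\|_X \geq \|\varphi\|_X$ holds whenever $f$ is in $H$ and $\langle f,\varphi\rangle = 0$. *)

(* Defs.v *)
From HB Require Import structures.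
From mathcomp Require Import all_boot all_order all_algebra.
From mathcomp Require Import complex.
From mathcomp Require Import all_classical all_reals ereal topology normedtype.

Set Implicit Arguments.
Unset Strict Implicit.
Unset Printing Implicit Defensive.

Import Order.TTheory GRing.Theory Num.Theory.
Import numFieldNormedType.Exports.

Local Open Scope classical_set_scope.
Local Open Scope ring_scope.
Local Open Scope complex_scope.

(* The norm of a normed space over [R[i]] takes its values in [R[i]]; these
   values are real and nonnegative, so nothing is lost by taking [Re], which
   makes the supremum in [\bar R] available. *)
Definition op_norm (R : realType) (U V : normedModType R[i]) (T : U -> V) :
    \bar R :=
  ereal_sup [set (complex.Re `|T u|)%:E | u in [set u : U | `|u| <= 1]].

(* [{dot H for Num.conj}] is the type of positive definite Hermitian forms,
   linear in the first argument and conjugate-linear in the second; the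
   Hilbert space is the complete space [H] together with such a form that
   induces its norm. *)
Definition hilbert_space (R : realType) (H : completeNormedModType R[i])
    (ip : {dot H for Num.conj}) : Prop :=
  forall f : H, `|f| ^+ 2 = ip f f.

(* The embedding is a map [iota]; identifying [H] with its image, the norm
   in [X] of a vector [f] of [H] is [`|iota f|]. *)
Definition admissible_pair (R : realType) (H X : completeNormedModType R[i])
    (ip : {dot H for Num.conj}) (iota : {linear H -> X}) : Prop :=
  [/\ hilbert_space ip, injective iota, dense (range iota)
    & op_norm iota = 1%E].

Definition norm_attaining (R : realType) (H X : completeNormedModType R[i])
    (iota : {linear H -> X}) (phi : H) : Prop :=
  phi != 0 /\ `|iota phi| = `|phi|.

Definition hilbert_point (R : realType) (H X : completeNormedModType R[i])
    (ip : {dot H for Num.conj}) (iota : {linear H -> X}) (phi : H) : Prop :=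
  phi != 0 /\
  forall f : H, ip f phi = 0 -> `|iota phi| <= `|iota (phi + f)|.

(* Main.v *)
Require Import Defs.
From mathcomp Require Import all_boot all_order all_algebra.
From mathcomp Require Import complex ring.
From mathcomp Require Import all_classical all_reals ereal topology normedtype.
Import Order.TTheory GRing.Theory Num.Theory.
Import numFieldNormedType.Exports.
Local Open Scope ring_scope.
Local Open Scope complex_scope.

(** Let [f] be orthogonal to [phi] and consider [t |-> |iota (phi + t f)|] on
    the real line. It is convex, equals [|phi|] at [t = 0] because [phi] is
    norm attaining, and, because [iota] is a contraction ([op_norm_le1]), is
    bounded above by [|phi + t f| = sqrt (|phi|^2 + t^2 |f|^2)]
    ([pythagoras]), which is [|phi| + O(t^2)]. If the value at [t = 1] were
    smaller than [|phi|], by [delta] say, convexity would force the value at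
    every [t = - s < 0] to be at least [|phi| + s delta], and this linear
    growth contradicts the quadratic bound as [s] tends to [0]
    ([le_of_quadratic_defect]). *)

(** Rescaling [u] to the unit sphere brings it into the range of the supremum
    that defines [op_norm]; the values of [|T u|], being real, are then
    compared through their real parts. *)
Lemma op_norm_le1 (R : realType) (U V : normedModType R[i])
    (T : {linear U -> V}) (u : U) :
  (op_norm T <= 1)%E -> `|T u| <= `|u|.
Proof.
move=> T1; have [->|u0] := eqVneq u 0; first by rewrite linear0 !normr0.
have nu0 : 0 < `|u| by rewrite normr_gt0.
set v := `|u|^-1 *: u.
have v1 : `|v| = 1.
  by rewrite /v normrZ normfV normr_id mulVf // gt_eqF.
have Re_le1 : complex.Re `|T v| <= 1.
  rewrite -lee_fin; apply: le_trans T1.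
  by apply: ereal_sup_ubound; exists v => //=; rewrite v1.
have Tv1 : `|T v| <= 1.
  have /RRe_real <- : `|T v| \is Num.real by exact: normr_real.
  by rewrite -(rmorph1 (real_complex R)) lecR.
by move: Tv1; rewrite linearZ normrZ normfV normr_id mulrC ler_pdivrMr // mul1r.
Qed.

Lemma pythagoras (R : realType) (H : completeNormedModType R[i])
    (ip : {dot H for Num.conj}) (phi f : H) (s : R[i]) :
  hilbert_space ip -> ip f phi = 0 ->
  `|phi - s *: f| ^+ 2 = `|phi| ^+ 2 + `|s| ^+ 2 * `|f| ^+ 2.
Proof.
move=> hip fphi; have orth : ip ((- s) *: f) phi = 0.
  by rewrite linearZl_LR /= fphi mulr0.
rewrite addrC -scaleNr -(normrN s) -exprMn -normrZ [RHS]addrC !hip.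
exact: hnormDd.
Qed.

(** The hypothesis says [a + s (a - c) <= n] where [n] is the square root of
    [a^2 + s^2 b^2], given by its square since [K] may lack square roots. If
    [c < a], squaring yields [2 a (a - c) <= s b^2] for every [s > 0], which
    fails for small [s]. *)
Lemma le_of_quadratic_defect (K : numFieldType) (a b c : K) :
  0 <= b -> 0 <= c ->
  (forall s, 0 < s -> exists2 n : K, n ^+ 2 = a ^+ 2 + s ^+ 2 * b ^+ 2 &
     0 <= n /\ (1 + s) * a <= n + s * c) ->
  0 <= a -> a <= c.
Proof.
move=> b0 c0 defect a0; rewrite real_leNgt ?ger0_real //; apply/negP => ca.
have d0 : 0 < a - c by rewrite subr_gt0.
have ad0 : 0 < a * (a - c) by rewrite mulr_gt0 // (le_lt_trans c0).
have b1 : 0 < b ^+ 2 + 1 by rewrite ltr_wpDl // exprn_ge0.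
(* Any [s] with [s b^2 < 2 a (a - c)] would do; adding [1] to the denominator
   covers [b = 0]. *)
pose s := a * (a - c) / (b ^+ 2 + 1).
have s0 : 0 < s by rewrite divr_gt0.
have sE : s * b ^+ 2 = a * (a - c) - s.
  by rewrite /s; field; rewrite gt_eqF.
have [n n2 [n0 le_n]] := defect s s0.
have le_n' : a + s * (a - c) <= n.
  rewrite -(lerD2r (s * c)).
  by have -> : a + s * (a - c) + s * c = (1 + s) * a by ring.
have : (a + s * (a - c)) ^+ 2 <= n ^+ 2.
  by rewrite ler_sqr // nnegrE addr_ge0 // mulr_ge0 // ltW.
rewrite n2 -subr_ge0.
have -> : a ^+ 2 + s ^+ 2 * b ^+ 2 - (a + s * (a - c)) ^+ 2 =
    - (s * (a * (a - c) + s + s * (a - c) ^+ 2)).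
  by rewrite [s ^+ 2]expr2 -mulrA sE; ring.
apply/negP; rewrite oppr_ge0 lt_geF // mulr_gt0 // ltr_wpDr ?addr_gt0 //.
by rewrite mulr_ge0 ?exprn_ge0 ?ltW.
Qed.

Theorem corollary3 (R : realType) (H X : completeNormedModType R[i])
    (ip : {dot H for Num.conj}) (iota : {linear H -> X}) :
  admissible_pair ip iota ->
  forall phi : H, phi != 0 ->
    norm_attaining iota phi -> hilbert_point ip iota phi.
Proof.
move=> [hip _ _ iota1] phi phi0 [_ phi_attains]; split=> // f fphi.
have contraction u : `|iota u| <= `|u| by apply: op_norm_le1; rewrite iota1.
rewrite phi_attains.
apply: (@le_of_quadratic_defect _ _ `|f|) => // s s0.
exists `|phi - s *: f|.
  by rewrite (pythagoras _ _ _ _ _ _ hip fphi) gtr0_norm.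
split=> //.
(* Convexity: [phi] lies on the segment from [phi - s f] to [phi + f]. *)
have phiE : (1 + s) *: phi = (phi - s *: f) + s *: (phi + f).
  by rewrite scalerDr scalerDl scale1r addrACA addNr addr0.
rewrite -phi_attains -[X in X * _]gtr0_norm ?addr_gt0 //.
rewrite -normrZ -linearZ phiE linearD (linearZ_LR iota).
apply: le_trans (ler_normD _ _) _.
by rewrite /= normrZ (gtr0_norm s0) lerD2r contraction.
Qed.
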